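(* Let $d\ge 1$ and let $\mathcal{F}$ be a finite family of axis-parallel boxes in $\mathbb{R}^d$. Suppose that there exists a maximum matching $\mathcal{M}$ in $\mathcal{F}$ such that for every $F\in\mathcal{F}$ and $M\in\mathcal{M}$, at least one of the following holds: (1) $F$ contains a corner of $M$; (2) $F\cap M=\emptyset$; (3) $M$ contains at least $2^{d-1}$ corners of $F$. Then $\tau(\mathcal{F}) \leq (2^d+(4+d)d)\,\nu(\mathcal{F})$.
   Context: An axis-parallel box in $\mathbb{R}^d$ is a set $[x_1,y_1]\times\dots\times[x_d,y_d]$ with $x_i<y_i$ for all $i$; its corners are its $2^d$ zero-dimensional faces (vertices). A matching in $\mathcal{F}$ is a subfamily of pairwise disjoint boxes; $\nu(\mathcal{F})$ is the maximum size of a matching in $\mathcal{F}$, and a maximum matching is one of size $\nu(\mathcal{F})$. The covering number $\tau(\mathcal{F})$ is the minimum size of a set of points in $\mathbb{R}^d$ that meets every box in $\mathcal{F}$. *)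

(* Defs.v *)
From HB Require Import structures.
From mathcomp Require Import all_boot all_order all_algebra finmap.
From mathcomp Require Import boolp classical_sets reals.

Set Implicit Arguments.
Unset Strict Implicit.
Unset Printing Implicit Defensive.

Import Order.TTheory GRing.Theory Num.Theory.

Local Open Scope classical_set_scope.
Local Open Scope ring_scope.
Local Open Scope fset_scope.

Record box (R : realType) (d : nat) := Box {
  lo : 'rV[R]_d;
  hi : 'rV[R]_d;
  lo_lt_hi : forall i : 'I_d, lo 0 i < hi 0 i
}.

Section Boxes.
Context {R : realType} {d : nat}.
Implicit Type B : box R d.

Definition box_set B : set 'rV[R]_d :=
  [set x | forall i : 'I_d, lo B 0 i <= x 0 i <= hi B 0 i]%classic.

(* The subset s lists the coordinates in which the corner takes its upper
   value. *)
Definition corner B (s : {set 'I_d}) : 'rV[R]_d :=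
  \row_(i < d) (if i \in s then hi B 0 i else lo B 0 i).

Definition corners B : {fset 'rV[R]_d} :=
  [fset corner B s | s in [set: {set 'I_d}]%SET].

Lemma corner_inj B : injective (corner B).
Proof.
move=> s t /rowP st; apply/setP => i; have := st i; rewrite !mxE.
have := lo_lt_hi B i.
by case: (i \in s); case: (i \in t) => // + e; rewrite e ltxx.
Qed.

Lemma card_corners B : #|` corners B| = (2 ^ d)%N.
Proof.
rewrite card_imfset; last exact: corner_inj.
by rewrite /= -cardE -powersetT card_powerset cardsT card_ord.
Qed.

Lemma corner_in_box B (s : {set 'I_d}) : box_set B (corner B s).
Proof.
move=> i; rewrite mxE; have /ltW le := lo_lt_hi B i.
by case: (i \in s); rewrite lexx le.
Qed.

End Boxes.

(* A finite family of boxes is indexed by a finite type I, and its subfamilies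
   are the subsets of I. Two indices carrying the same box are never disjoint,
   so repetitions change neither nu nor tau. *)
Section Families.
Context {R : realType} {d : nat} {I : finType}.
Variable F : I -> box R d.

Definition matching (M : {set I}) : Prop :=
  trivIset [set` M]%classic (fun i => box_set (F i)).

Definition nu : nat := \max_(M : {set I} | `[< matching M >]) #|M|.

Definition maximum_matching (M : {set I}) : Prop :=
  matching M /\ #|M| = nu.

Definition is_cover (P : {fset 'rV[R]_d}) : Prop :=
  forall i : I, exists2 p, p \in P & box_set (F i) p.

Lemma exists_cover_size :
  exists n : nat, `[< exists2 P, is_cover P & #|` P| = n >].
Proof.
pose P := [fset corner (F i) finset.set0 | i in [set: I]%SET].
exists #|` P|; apply/asboolP; exists P => // i.
exists (corner (F i) finset.set0); last exact: corner_in_box.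
by apply/imfsetP; exists i => //=; rewrite inE.
Qed.

Definition tau : nat := ex_minn exists_cover_size.

End Families.

(* Main.v *)
Require Import Defs.
From mathcomp Require Import all_boot all_order all_algebra finmap.
From mathcomp Require Import boolp classical_sets reals.
From mathcomp Require Import zify.

Set Implicit Arguments.
Unset Strict Implicit.
Unset Printing Implicit Defensive.

Import Order.TTheory GRing.Theory Num.Theory.

(** Let M be the matching and nu its size. The tool used throughout is an
    exchange (disjoint_card_le_touched): since M is maximum, pairwise disjoint
    boxes X touch at least #|X| members of M, or else X could replace the
    members that it touches.

    The 2^d nu corners of M pierce every box that contains one of them. Let f
    be another box. Each member of M that f touches contains half of the corners
    of f, hence contains f except possibly along one axis, and contains an end
    of f there (pokes_of_half_corners). Two disjoint members must use the
    same axis and opposite ends of f (pokes_disjoint). So f touches exactly one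
    member, or it joins exactly two of them along an axis i (loner_or_joins).

    The boxes that touch only j in M pairwise intersect, by the exchange, and
    one point pierces them (pierced_loners). This uses nu points.

    For an axis i, view the pairs (a, b) joined by some box as arcs of a
    directed graph on M. Boxes of two arcs that do not follow one another are
    disjoint (joins_same_pair). Some directed cut keeps a quarter of the arcs,
    and no two arcs of a cut follow one another; choosing a box for each of them
    and exchanging gives at most 4 nu arcs (card_arcs). Similarly, at most nu
    arcs carry two disjoint boxes (card_doubled_arcs), and none carries three.
    All boxes of an arc overlap along axis i, so d points pierce the boxes of a
    doubled arc (pierced_no3disjoint) and one point those of any other arc.
    This makes 4 nu + (d - 1) nu points per axis.

    The total is 2^d nu + nu + d (3 + d) nu, and nu <= d nu gives the bound. *)

(** * Averaging over subsets *)

Section Subsets.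
Variable T : finType.

Lemma card_sets_prescribed2 (a b : T) (u v : bool) : a != b ->
  4 * #|[set S : {set T} | ((a \in S) == u) && ((b \in S) == v)]| = 2 ^ #|T|.
Proof.
move=> ab; pose c u' v' : {set {set T}} :=
  [set S : {set T} | ((a \in S) == u') && ((b \in S) == v')].
(* Toggling membership of one element is a bijection between two classes. *)
pose flip (x : T) (S : {set T}) := [set y | (y \in S) (+) (y == x)].
have flipK x : involutive (flip x).
  by move=> S; apply/setP => y; rewrite !inE addbK.
have card_flip x p q p' q' :
    {in c p q, forall S, flip x S \in c p' q'} -> #|c p q| <= #|c p' q'|.
  move=> sub; rewrite -(card_imset _ (inv_inj (flipK x))).
  by apply/subset_leq_card/fintype.subsetP => S' /imsetP[S /sub ? ->].
have flipa p q : #|c p q| <= #|c (~~ p) q|.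
  apply: (card_flip a) => S; rewrite !inE eqxx (eq_sym b) (negPf ab) addbF.
  by case/andP=> /eqP-> ->; rewrite addbT eqxx.
have flipb p q : #|c p q| <= #|c p (~~ q)|.
  apply: (card_flip b) => S; rewrite !inE eqxx (negPf ab) addbF.
  by case/andP=> -> /eqP->; rewrite addbT eqxx.
have total : 2 ^ #|T| =
    #|c true true| + #|c true false| + (#|c false true| + #|c false false|).
  rewrite -cardsT -card_powerset powersetT.
  rewrite -(cardsID [set S : {set T} | a \in S] [set: {set T}]).
  rewrite -(cardsID [set S : {set T} | b \in S] (_ :&: _)).
  rewrite -(cardsID [set S : {set T} | b \in S] ([set: _] :\: _)).
  congr (_ + _ + (_ + _)); apply: eq_card => S; rewrite !inE;
    by case: (a \in S); case: (b \in S).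
move: (flipa true true) (flipa true false) (flipa false true).
move: (flipa false false) (flipb true true) (flipb true false).
move: (flipb false true) (flipb false false) total.
rewrite -/(c u v) /=; case: u v => -[]; 
  move: (2 ^ _) #|c true true| #|c true false|;
  by move: #|c false true| #|c false false| => *; lia.
Qed.

(** A uniformly random vertex set S separates a given arc in a given direction
    with probability one quarter, so some cut carries a quarter of the arcs. *)
Lemma card_arcs_le_directed_cut (E : {set T * T}) (m : nat) :
  {in E, forall e, e.1 != e.2} ->
  (forall S : {set T},
     #|[set e in E | (e.1 \in S) && (e.2 \notin S)]| <= m) ->
  #|E| <= 4 * m.
Proof.
move=> loopless cut; rewrite -(@leq_pmul2l (2 ^ #|T|)) ?expn_gt0//.
have -> : 2 ^ #|T| * #|E| =
    4 * \sum_(S : {set T}) #|[set e in E | (e.1 \in S) && (e.2 \notin S)]|.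
  have -> : \sum_(S : {set T}) #|[set e in E | (e.1 \in S) && (e.2 \notin S)]| =
      \sum_(e in E) #|[set S : {set T} | (e.1 \in S) && (e.2 \notin S)]|.
    under [RHS]eq_bigr do rewrite -sum1_card big_mkcond.
    rewrite exchange_big; apply: eq_bigr => S _.
    rewrite -sum1_card [LHS]big_mkcond [RHS]big_mkcond; apply: eq_bigr => e _.
    by rewrite !inE; case: (e \in E).
  rewrite big_distrr mulnC -sum_nat_const; apply: eq_bigr => e /loopless ne.
  rewrite -(card_sets_prescribed2 true false ne); congr (4 * _).
  by apply: eq_card => S; rewrite !inE; case: (e.1 \in S); case: (e.2 \in S).
rewrite mulnCA leq_pmul2l // -cardsT -card_powerset powersetT cardsT.
by rewrite -sum_nat_const leq_sum.
Qed.

End Subsets.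

(** * Boxes in contact *)

Section BoxGeometry.
Local Open Scope ring_scope.
Context {R : realType} {d : nat}.
Implicit Types B C D : box R d.

Definition meet B C : bool :=
  [forall k, (lo B 0 k <= hi C 0 k) && (lo C 0 k <= hi B 0 k)].

Lemma meetP B C :
  reflect (forall k, lo B 0 k <= hi C 0 k /\ lo C 0 k <= hi B 0 k) (meet B C).
Proof. by apply: (iffP forallP) => h k; have /andP := h k. Qed.

Lemma meet_common_point B C :
  meet B C <-> (box_set B `&` box_set C !=set0)%classic.
Proof.
split=> [/meetP BC|[x [xB xC]]].
  exists (\row_k Num.max (lo B 0 k) (lo C 0 k)).
  split=> k; rewrite mxE; have [BC1 BC2] := BC k;
  by rewrite le_max ge_max lexx ?orbT ?BC1 ?BC2 ?(ltW (lo_lt_hi _ _)).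
apply/meetP => k; have /andP[Bx xB'] := xB k; have /andP[Cx xC'] := xC k.
by rewrite (le_trans Bx xC') (le_trans Cx xB').
Qed.

Lemma meetxx B : meet B B.
Proof. by apply/meetP => k; rewrite (ltW (lo_lt_hi _ _)). Qed.

Lemma meet_sym B C : meet B C = meet C B.
Proof. by apply/meetP/meetP => h k; have [] := h k. Qed.

Definition endpoint (e : bool) B (k : 'I_d) : R :=
  if e then hi B 0 k else lo B 0 k.

(** The shape of B against C when C contains half of the corners of B: B can
    leave C only along axis i and only at one end, the end e staying in C. *)
Definition pokes (i : 'I_d) (e : bool) B C : bool :=
  [forall k, (k != i) ==> (lo C 0 k <= lo B 0 k) && (hi B 0 k <= hi C 0 k)] &&
  (lo C 0 i <= endpoint e B i <= hi C 0 i).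

Lemma pokesP i e B C :
  reflect ((forall k, k != i -> lo C 0 k <= lo B 0 k /\ hi B 0 k <= hi C 0 k) /\
           (lo C 0 i <= endpoint e B i <= hi C 0 i)) (pokes i e B C).
Proof.
apply: (iffP andP) => -[sub mem]; split=> //.
  by move=> k ki; have /implyP/(_ ki)/andP := forallP sub k.
by apply/forallP => k; apply/implyP => /sub/andP.
Qed.

Lemma endpoint_bounds e B k : lo B 0 k <= endpoint e B k <= hi B 0 k.
Proof. by case: e; rewrite /= lexx (ltW (lo_lt_hi _ _)). Qed.

(** If B leaves C along at most one axis, and D along at most one axis, then B
    pins C and D together along every other axis. Hence disjointness of C and D
    forces the two axes to agree, and the two ends of B to be used up. *)
Lemma pokes_disjoint i e j e' B C D :
  pokes i e B C -> pokes j e' B D -> ~~ meet C D -> i = j /\ e' = ~~ e.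
Proof.
move=> /pokesP[BC iC] /pokesP[BD jD] /negP nCD.
have lh k := ltW (lo_lt_hi B k).
have out k : k != i -> k != j -> lo C 0 k <= hi D 0 k /\ lo D 0 k <= hi C 0 k.
  move=> /BC[lC hC] /BD[lD hD]; split.
    exact: le_trans lC (le_trans (lh k) hD).
  exact: le_trans lD (le_trans (lh k) hC).
have [ij|ij] := eqVneq i j; last first.
  case: nCD; apply/meetP => k; have [->|ki] := eqVneq k i.
    have [lD hD] := BD i ij; have /andP[lB hB] := endpoint_bounds e B i.
    have /andP[lC hC] := iC; split.
      exact: le_trans lC (le_trans hB hD).
    exact: le_trans lD (le_trans lB hC).
  have [->|kj] := eqVneq k j; last exact: out.
  have ji : j != i by rewrite eq_sym.
  have [lC hC] := BC j ji; have /andP[lB hB] := endpoint_bounds e' B j.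
  have /andP[lD hD] := jD; split.
    exact: le_trans lC (le_trans lB hD).
  exact: le_trans lD (le_trans hB hC).
split=> //; apply/eqP; rewrite -addbT -[_ == _]negbK.
apply/negP => /= ee'; have {}ee' : e' = e by case: e e' ee' {iC jD} => -[].
subst j e'; case: nCD; apply/meetP => k.
have [->|ki] := eqVneq k i; last exact: out.
have /andP[lC hC] := iC; have /andP[lD hD] := jD.
by rewrite (le_trans lC hD) (le_trans lD hC).
Qed.

(** The corners of B inside C form a product set, so each axis along which B
    leaves C halves their number. *)
Lemma pokes_of_half_corners B C : (0 < d)%N ->
  (2 ^ d.-1 <=
     #|` [fset p in corners B | p \in box_set C]%fset|)%N ->
  exists i e, pokes i e B C.
Proof.
move=> d_gt0; pose A := [set s : {set 'I_d} | corner B s \in box_set C].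
have -> : #|` [fset p in corners B | p \in box_set C]%fset| = #|A|.
  have -> : [fset p in corners B | p \in box_set C]%fset =
            [fset corner B s | s in A]%fset.
    apply/fsetP => p; rewrite !inE /=; apply/andP/imfsetP => /=.
      by case=> /imfsetP[s _ ->] sC; exists s; rewrite // finset.in_set.
    case=> s; rewrite finset.in_set => sC ->; split=> //.
    by apply/imfsetP; exists s; rewrite ?inE.
  by rewrite card_imfset /= -?cardE //; exact: corner_inj.
move=> half; have /card_gt0P[s0] : (0 < #|A|)%N.
  by rewrite (leq_trans _ half) // expn_gt0.
rewrite inE => /set_mem s0C.
pose sub k := (lo C 0 k <= lo B 0 k) && (hi B 0 k <= hi C 0 k).
have forced s k : s \in A -> ~~ sub k -> (k \in s) == (hi B 0 k <= hi C 0 k).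
  rewrite inE => /set_mem /(_ k); rewrite mxE /sub.
  case: (k \in s) => /andP[lB hB]; first by rewrite hB.
  by rewrite lB /=; case: (_ <= _).
have unique a b : ~~ sub a -> ~~ sub b -> a = b.
  move=> na nb; apply/eqP; apply: contraT => ab.
  have := card_sets_prescribed2
    (hi B 0 a <= hi C 0 a) (hi B 0 b <= hi C 0 b) ab.
  set S := finset _; have AS : (#|A| <= #|S|)%N.
    apply/subset_leq_card/fintype.subsetP => s sA.
    by rewrite inE !forced.
  have dbl : (2 ^ d = 2 * 2 ^ d.-1)%N by rewrite -expnS prednK.
  rewrite card_ord dbl => eqS.
  have pos : (0 < 2 ^ d.-1)%N by rewrite expn_gt0.
  move: half AS eqS pos; move: (2 ^ _)%N #|A| #|S| => x y z; lia.
have [i isub] : exists i, forall k, k != i -> sub k.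
  have [/existsP[i ni]|/existsPn all] := boolP [exists i, ~~ sub i].
    exists i => k; apply: contraNT => nk; apply/eqP; exact: unique.
  by exists (Ordinal d_gt0) => k _; rewrite -[sub k]negbK.
exists i, (i \in s0); apply/pokesP; split=> [k /isub/andP //|].
by have := s0C i; rewrite mxE /endpoint.
Qed.

End BoxGeometry.

(** * Piercing families of boxes *)

Section Piercing.
Local Open Scope ring_scope.
Context {R : realType} {d : nat} {I : finType}.
Variable F : I -> box R d.
Implicit Types (X Y : {set I}) (n : nat).

Definition pierced X n : Prop :=
  exists2 s : seq 'rV[R]_d, (size s <= n)%N &
    {in X, forall f, exists2 p, p \in s & box_set (F f) p}.

Lemma tau_le n : pierced [set: I] n -> (tau F <= n)%N.
Proof.
case=> s sn cover; rewrite /tau; case: ex_minnP => m _ minm.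
apply: leq_trans sn; apply: leq_trans (minm #|` [fset p in s]%fset| _) _.
  apply/asboolP; exists [fset p in s]%fset => // i.
  by have [//|p ps ip] := cover i _; exists p; rewrite ?inE.
by rewrite card_fseq size_undup.
Qed.

Lemma pierced0 : pierced finset.set0 0.
Proof. by exists [::] => // f; rewrite inE. Qed.

Lemma piercedS X Y n : X \subset Y -> pierced Y n -> pierced X n.
Proof.
move=> /fintype.subsetP XY [s sn cover]; exists s => // f /XY; exact: cover.
Qed.

Lemma pierced_leq X m n : (m <= n)%N -> pierced X m -> pierced X n.
Proof. by move=> mn [s sm cover]; exists s => //; exact: leq_trans mn. Qed.

Lemma piercedU X Y m n :
  pierced X m -> pierced Y n -> pierced (X :|: Y) (m + n).
Proof.
move=> [s sm coverX] [t tn coverY]; exists (s ++ t).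
  by rewrite size_cat leq_add.
move=> f /setUP[/coverX|/coverY] [p pin fp]; exists p => //;
by rewrite mem_cat pin ?orbT.
Qed.

Lemma pierced_bigcup (J : finType) (D : {set J}) (X : J -> {set I})
    (n : J -> nat) :
  {in D, forall j, pierced (X j) (n j)} ->
  pierced (\bigcup_(j in D) X j)%SET (\sum_(j in D) n j).
Proof.
move=> pX; apply: (big_rec2 pierced) => [|j m Y jD pY]; first exact: pierced0.
exact: piercedU (pX j jD) pY.
Qed.

(** Helly for boxes: take in each coordinate the largest lower end. *)
Lemma pierced1 X : {in X &, forall f g, meet (F f) (F g)} -> pierced X 1.
Proof.
move=> XX; have [->|[f0 f0X]] := set_0Vmem X.
  exact: pierced_leq pierced0.
pose top k := [arg max_(f > f0 | f \in X) lo (F f) 0 k]%O.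
exists [:: \row_k lo (F (top k)) 0 k] => // f fX.
exists (\row_k lo (F (top k)) 0 k); rewrite ?mem_head // => k; rewrite mxE /top.
case: arg_maxP => //= g gX max; rewrite max //=.
by have /meetP/(_ k)[] := XX g f gX fX.
Qed.

(** Sweep along an axis in K: cut the family by the hyperplane through the
    lowest upper end along that axis, that of f0 say. Boxes beyond the
    hyperplane miss f0, so no two of them are disjoint and one point pierces
    them; boxes cut by the hyperplane overlap along one axis more. *)
Lemma pierced_no3disjoint (K : {set 'I_d}) X :
  {in X & &, forall f g h,
    [|| meet (F f) (F g), meet (F f) (F h) | meet (F g) (F h)]} ->
  {in X &, forall f g k, k \notin K -> lo (F f) 0 k <= hi (F g) 0 k} ->
  pierced X #|K|.+1.
Proof.
have [m] := ubnP #|K|; elim: m K X => // m IHm K X; rewrite ltnS => Km no3 over.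
have [K0|[k kK]] := set_0Vmem K.
  rewrite K0 cards0; apply: pierced1 => f g fX gX.
  by apply/meetP => k; split; apply: over => //; rewrite K0 inE.
have [->|[f1 f1X]] := set_0Vmem X; first exact: pierced_leq pierced0.
pose f0 := [arg min_(f < f1 | f \in X) hi (F f) 0 k]%O.
have [f0X f0min] : f0 \in X /\ {in X, forall f, hi (F f0) 0 k <= hi (F f) 0 k}.
  by rewrite /f0; case: arg_minP.
pose X1 := [set f in X | lo (F f) 0 k <= hi (F f0) 0 k].
pose X2 := [set f in X | hi (F f0) 0 k < lo (F f) 0 k].
have -> : X = X1 :|: X2.
  by apply/setP => f; rewrite !inE -andb_orr leNgt orNb andbT.
have cardK : #|K| = #|K :\ k|.+1 by rewrite (cardsD1 k K) kK.
rewrite cardK -[(_.+1).+1]addn1; apply: piercedU.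
  apply: IHm; first by rewrite -cardK.
    by move=> f g h /setIdP[? _] /setIdP[? _] /setIdP[? _]; exact: no3.
  move=> f g /setIdP[fX flo] /setIdP[gX _] l; rewrite !inE negb_and negbK.
  by case/orP=> [/eqP->|lK]; [exact: le_trans flo (f0min _ gX) | exact: over].
apply: pierced1 => f g /setIdP[fX flo] /setIdP[gX glo].
have miss h : hi (F f0) 0 k < lo (F h) 0 k -> ~~ meet (F f0) (F h).
  by move=> hlo; apply/negP => /meetP/(_ k)[_]; rewrite leNgt hlo.
by have := no3 f0 f g f0X fX gX; rewrite (negPf (miss f _)) ?(negPf (miss g _)).
Qed.

End Piercing.

(** * Boxes joining two members of a maximum matching *)

Section MaximumMatching.
Local Open Scope ring_scope.
Context {R : realType} {d : nat} {I : finType}.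
Variables (F : I -> box R d) (M : {set I}).
Hypothesis maxM : maximum_matching F M.
Implicit Types (a b c f g : I) (X V S : {set I}) (i : 'I_d).

Definition touch f g : bool := meet (F f) (F g).

Lemma touch_sym f g : touch f g = touch g f.
Proof. exact: meet_sym. Qed.

Lemma matchingP X :
  matching F X <-> {in X &, forall f g, touch f g -> f = g}.
Proof.
by split=> mX f g fX gX /meet_common_point; exact: mX.
Qed.

Lemma matching_disjoint a b : a \in M -> b \in M -> a != b -> ~~ touch a b.
Proof.
by move=> aM bM; apply: contraNN => /((matchingP M).1 maxM.1 a b aM bM)/eqP.
Qed.

(** Exchange: replacing in M the members that touch X by X itself leaves a
    matching. *)
Lemma disjoint_card_le_touched X V :
  {in X &, forall f g, touch f g -> f = g} ->
  {in X & M, forall f j, touch f j -> j \in V} ->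
  (#|X| <= #|V|)%N.
Proof.
move=> mX XV; pose N := (M :\: V) :|: X.
have mN : matching F N.
  apply/matchingP => f g /setUP[/setDP[fM fV]|fX] /setUP[/setDP[gM gV]|gX] fg.
  - exact: (matchingP M).1 maxM.1 f g fM gM fg.
  - by rewrite touch_sym in fg; rewrite (XV g f) in fV.
  - by rewrite (XV f g) in gV.
  - exact: mX.
have : (#|N| <= #|M|)%N.
  by rewrite maxM.2; apply: leq_bigmax_cond; exact/asboolP.
have : (M :\: V) :&: X = finset.set0.
  apply/setP => f; rewrite !inE; apply/negP => /andP[/andP[fV fM] fX].
  by rewrite (XV f f) ?/touch ?meetxx in fV.
rewrite cardsU => ->; rewrite cards0 cardsD.
have := subset_leq_card (subsetIr M V); have := subset_leq_card (subsetIl M V).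
by move: #|M| #|V| #|X| #|M :&: V| => *; lia.
Qed.

Lemma disjoint_seq_size_le_touched (s : seq I) V :
  pairwise (fun f g => ~~ touch f g) s ->
  {in s & M, forall f j, touch f j -> j \in V} ->
  (size s <= #|V|)%N.
Proof.
move=> dis sV.
have eq_s : {in s &, forall f g, touch f g -> f = g}.
  move=> f g fs gs; apply: contraTeq.
  elim: s dis {sV} fs gs => //= h s IHs /andP[/allP hs ds].
  rewrite !inE => /orP[/eqP->|fs] /orP[/eqP->|gs]; rewrite ?eqxx //.
  - by move=> _; exact: hs.
  - by move=> _; rewrite touch_sym; exact: hs.
  - exact: IHs.
have <- : #|[set:: s]| = size s.
  rewrite cardsE; apply/card_uniqP; rewrite uniq_pairwise.
  apply: sub_pairwise dis => f g; apply: contraNneq => ->; exact: meetxx.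
apply: disjoint_card_le_touched => [f g|f j]; rewrite !inE.
  exact: eq_s.
exact: sV.
Qed.

(** Box f joins a to b along axis i: the parallel to axis i through a point of
    f leaves a upwards and next enters b. *)
Definition joins i f a b : bool :=
  [&& a \in M, b \in M, a != b, pokes i false (F f) (F a),
      pokes i true (F f) (F b) &
      [forall c in M, touch f c ==> ((c == a) || (c == b))]].

Lemma joinsP i f a b : joins i f a b ->
  [/\ [/\ a \in M, b \in M & a != b], pokes i false (F f) (F a),
      pokes i true (F f) (F b) &
      {in M, forall c, touch f c -> (c == a) || (c == b)}].
Proof.
case/and5P=> aM bM ab fa /andP[fb /forall_inP only]; split=> // c cM.
exact/implyP/only.
Qed.

(** Of two boxes that meet, the one whose starting member ends lower along axis
    i has to reach the starting member of the other, and so touches it. It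
    touches nothing in M but its own start and end, so the two starts agree. The
    argument for the ends is the mirror image. The inequalities exclude a chain,
    where one box arrives in the member from which the other starts and the two
    may well meet inside it. *)
Lemma joins_same_pair i f g a b a' b' :
  joins i f a b -> joins i g a' b' -> a != b' -> a' != b -> touch f g ->
  a = a' /\ b = b'.
Proof.
move=> /joinsP[[aM bM ab] /pokesP[fa /andP[/= laf fha]]
  /pokesP[fb /andP[/= lbf fhb]] only].
move=> /joinsP[[a'M b'M ab'] /pokesP[ga /andP[/= lag gha]]
  /pokesP[gb /andP[/= lbg ghb]] only'].
move=> nab' na'b fg.
(* A box meeting f also meets any c that contains f except along axis i, as
   soon as they overlap along axis i. *)
have reach f' g' c : touch f' g' ->
    (forall k, k != i -> lo (F c) 0 k <= lo (F f') 0 k /\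
                         hi (F f') 0 k <= hi (F c) 0 k) ->
    lo (F g') 0 i <= hi (F c) 0 i -> lo (F c) 0 i <= hi (F g') 0 i ->
    touch g' c.
  move=> /meetP fg' sub l1 l2; apply/meetP => k; have [->//|ki] := eqVneq k i.
  have [lc hc] := sub k ki; have [lfg lgf] := fg' k.
  by rewrite (le_trans lgf hc) (le_trans lc lfg).
have gf : touch g f by rewrite touch_sym.
have /meetP/(_ i)[lfg lgf] := fg.
split.
  have [le|/ltW le] := lerP (hi (F a') 0 i) (hi (F a) 0 i).
    have ga' : touch g a.
      exact: reach fg fa (le_trans gha le) (le_trans laf lfg).
    by have /orP[/eqP//|] := only' a aM ga'; rewrite (negPf nab').
  have fa' : touch f a'.
    exact: reach gf ga (le_trans fha le) (le_trans lag lgf).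
  by have := only a' a'M fa'; rewrite (negPf na'b) orbF => /eqP.
have [le|/ltW le] := lerP (lo (F b) 0 i) (lo (F b') 0 i).
  have gb' : touch g b.
    exact: reach fg fb (le_trans lgf fhb) (le_trans le lbg).
  by have := only' b bM gb'; rewrite eq_sym (negPf na'b) => /eqP.
have fb' : touch f b'.
  exact: reach gf gb (le_trans lfg ghb) (le_trans le lbf).
by have := only b' b'M fb'; rewrite eq_sym (negPf nab') => /eqP.
Qed.

Definition joining i (e : I * I) : {set I} := [set f | joins i f e.1 e.2].

Definition arcs i : {set I * I} := [set e | joining i e != finset.set0].

Definition doubled_arcs i : {set I * I} :=
  [set e | [exists f in joining i e, exists g in joining i e, ~~ touch f g]].

(** The arcs cut by S have no head that is the tail of another one, so boxes
    representing them are pairwise disjoint and the exchange bounds their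
    number by the size of M. *)
Lemma card_arcs i : (#|arcs i| <= 4 * #|M|)%N.
Proof.
apply: card_arcs_le_directed_cut => [e|S].
  by rewrite inE => /set0Pn[f]; rewrite inE => /joinsP[[]].
set E := finset _; pose r e := odflt e.1 [pick f in joining i e].
have rP e : e \in E -> [/\ joins i (r e) e.1 e.2, e.1 \in S & e.2 \notin S].
  rewrite !inE => /andP[/set0Pn[f fe] /andP[-> ->]]; split=> //.
  by rewrite /r; case: pickP => [g|/(_ f)]; rewrite ?fe //= inE.
have r_touch : {in E &, forall e e', touch (r e) (r e') -> e = e'}.
  move=> [a b] [a' b'] /rP[/= re aS bS] /rP[/= re' aS' bS'].
  case/(joins_same_pair re re').
  - by apply: contraNneq bS' => <-.
  - by apply: contraNneq bS => <-.
  - by move=> -> ->.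
rewrite -(@card_in_imset _ _ r E).
  apply: disjoint_card_le_touched => // _ _ /imsetP[e eE ->] /imsetP[e' eE' ->].
  by move=> /r_touch->.
by move=> e e' eE eE' ree'; apply: r_touch; rewrite // ree' /touch meetxx.
Qed.

(** Two doubled arcs with a common tail would give four disjoint boxes that
    touch only three members of M. *)
Lemma card_doubled_arcs i : (#|doubled_arcs i| <= #|M|)%N.
Proof.
rewrite -(@card_in_imset _ _ fst (mem (doubled_arcs i))).
  apply/subset_leq_card/fintype.subsetP => _ /imsetP[e + ->]; rewrite inE.
  by case/exists_inP=> f; rewrite inE => /joinsP[[]].
move=> [a b] [a' c]; rewrite !inE => ab_doubled ac_doubled /= aa'; subst a'.
congr (_, _); apply/eqP; apply: contraT => bc.
case/exists_inP: ab_doubled => f1 + /exists_inP[f2].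
case/exists_inP: ac_doubled => g1 + /exists_inP[g2].
rewrite !inE /= => g1e g2e g12 f1e f2e f12.
have apart f g : joins i f a b -> joins i g a c -> ~~ touch f g.
  move=> fe ge; have [[_ _ ab] _ _ _] := joinsP fe.
  have [[_ _ ac] _ _ _] := joinsP ge.
  by apply: contraNN bc => /(joins_same_pair fe ge ac ab)[_ ->].
have : (size [:: f1; f2; g1; g2] <= #|[set a; b; c]|)%N.
  apply: disjoint_seq_size_le_touched.
    by rewrite /= f12 g12 !apart.
  move=> f j fs jM; rewrite !inE in fs *; case/or4P: fs => /eqP-> t.
  - by have [_ _ _ /(_ j jM t)->] := joinsP f1e.
  - by have [_ _ _ /(_ j jM t)->] := joinsP f2e.
  - by have [_ _ _ /(_ j jM t)/orP[]->] := joinsP g1e; rewrite ?orbT.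
  - by have [_ _ _ /(_ j jM t)/orP[]->] := joinsP g2e; rewrite ?orbT.
rewrite cardsU cards1; have := leq_trans (leq_card_setU [set a] [set b]).
move=> /(_ 2); rewrite !cards1 => /(_ isT) ab2.
by rewrite leqNgt ltnS (leq_trans (leq_subr _ _)) // addn1 ltnS.
Qed.

(** All boxes of an arc cross the gap between its two members, so only the other
    d - 1 axes matter; and three of them cannot be disjoint. *)
Lemma pierced_joining i e :
  pierced F (joining i e) (1 + (e \in doubled_arcs i) * d.-1).
Proof.
have [dbl|single] := boolP (e \in doubled_arcs i); last first.
  rewrite mul0n addn0; apply: pierced1 => f g fe ge; apply: contraNT single.
  rewrite inE => fg; apply/exists_inP; exists f => //.
  by apply/exists_inP; exists g.
rewrite mul1n add1n; have -> : d.-1 = #|~: [set i]| by rewrite cardsC1 card_ord.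
apply: pierced_no3disjoint => [f g h fe ge he|f g].
  apply: contraT; rewrite !negb_or => /and3P[fg fh gh].
  have : (size [:: f; g; h] <= #|[set e.1; e.2]|)%N.
    apply: disjoint_seq_size_le_touched; first by rewrite /= /touch fg fh gh.
    move=> x j; rewrite !inE => /or3P[] /eqP-> jM t.
    - by move: fe; rewrite inE => /joinsP[_ _ _ ->].
    - by move: ge; rewrite inE => /joinsP[_ _ _ ->].
    - by move: he; rewrite inE => /joinsP[_ _ _ ->].
  by rewrite cards2; case: (_ != _).
rewrite !inE => /joinsP[[aM bM ab] /pokesP[fa /andP[/= laf fha]]
  /pokesP[fb /andP[/= _ fhb]] _].
move=> /joinsP[_ _ /pokesP[_ /andP[/= lbg _]] _] k.
rewrite !inE negbK => /eqP->.
(* Otherwise the upper end of e.1 is beyond the lower end of e.2 on axis i, and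
   f makes these two boxes overlap along the other axes. *)
have [//|gf] := lerP (lo (F f) 0 i) (hi (F g) 0 i).
have /negP[] := matching_disjoint aM bM ab; apply/meetP => l.
have lf := ltW (lo_lt_hi (F f) l).
have [li|li] := eqVneq l i.
  rewrite li in lf *; split; first exact: le_trans laf (le_trans lf fhb).
  exact: le_trans lbg (le_trans (ltW gf) fha).
have [la ha] := fa l li; have [lb hb] := fb l li; split.
  exact: le_trans la (le_trans lf hb).
exact: le_trans lb (le_trans lf ha).
Qed.

(** * Boxes containing no corner of the matching *)

Definition stabbed j : {set I} :=
  [set f | `[< exists2 p, p \in corners (F j) & box_set (F f) p >]].

Definition loners j : {set I} :=
  [set f | [forall c in M, touch f c ==> (c == j)]].

Lemma pierced_stabbed j : pierced F (stabbed j) (2 ^ d).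
Proof.
exists (corners (F j)); first by rewrite card_corners.
by move=> f; rewrite inE => /asboolP[p pj fp]; exists p.
Qed.

(** Two disjoint loners could replace j in M. *)
Lemma pierced_loners j : pierced F (loners j) 1.
Proof.
apply: pierced1 => f g fj gj; apply: contraT => fg.
have : (size [:: f; g] <= #|[set j]|)%N.
  apply: disjoint_seq_size_le_touched; first by rewrite /= /touch fg.
  move=> x c; rewrite !inE => /orP[]/eqP-> cM.
    by move: fj; rewrite inE => /forall_inP/(_ c cM)/implyP.
  by move: gj; rewrite inE => /forall_inP/(_ c cM)/implyP.
by rewrite cards1.
Qed.

Lemma touches_matching f : exists2 a, a \in M & touch f a.
Proof.
have /card_gt0P[a] : (0 < #|[set c in M | touch f c]|)%N.
  apply: (@disjoint_seq_size_le_touched [:: f]) => // g j.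
  by rewrite !inE => /eqP-> -> ->.
by case/setIdP; exists a.
Qed.

(** Every touched member of M swallows an end of f, and f has only two ends:
    f touches one member of M, or joins two. *)
Lemma loner_or_joins f :
  {in M, forall c, touch f c -> exists i e, pokes i e (F f) (F c)} ->
  (exists2 j, j \in M & f \in loners j) \/ (exists i a b, joins i f a b).
Proof.
move=> fM; have [a aM fa] := touches_matching f.
have [fl|] := boolP (f \in loners a); first by left; exists a.
rewrite inE => /forall_inPn[b bM]; rewrite negb_imply => /andP[fb ba]; right.
have [i [e pa]] := fM a aM fa; have [j [e' pb]] := fM b bM fb.
have ab : a != b by rewrite eq_sym.
have [ij e'e] := pokes_disjoint pa pb (matching_disjoint aM bM ab).
subst j e'.
have only c : c \in M -> touch f c -> (c == a) || (c == b).
  move=> cM fc; apply: contraT.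
  rewrite negb_or eq_sym (eq_sym c) => /andP[ac bc].
  have [k [e'' pc]] := fM c cM fc.
  have [_ e1] := pokes_disjoint pa pc (matching_disjoint aM cM ac).
  have [_] := pokes_disjoint pb pc (matching_disjoint bM cM bc).
  by rewrite e1; case: (e).
case: e pa pb => /= pa pb.
  exists i, b, a; rewrite /joins aM bM ba pa pb /=.
  by apply/forall_inP => c cM; apply/implyP => /(only c cM); rewrite orbC.
exists i, a, b; rewrite /joins aM bM ab pa pb /=.
by apply/forall_inP => c cM; apply/implyP => /(only c cM).
Qed.

End MaximumMatching.

Theorem theorem1p8 (R : realType) (d : nat) (I : finType) (F : I -> box R d)
  (hd : (1 <= d)%N)
  (hM : exists2 M : {set I}, maximum_matching F M &
    forall i j : I, j \in M ->
      [\/ exists2 p, p \in corners (F j) & box_set (F i) p,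
          (box_set (F i) `&` box_set (F j) = set0)%classic |
          (2 ^ d.-1 <=
           #|` [fset p in corners (F i) | p \in box_set (F j)]%fset|)%N]) :
  (tau F <= (2 ^ d + (4 + d) * d) * nu F)%N.
Proof.
have [M maxM hF] := hM; rewrite -maxM.2.
have cover : [set: I] \subset
    \bigcup_(j in M) stabbed F j :|: \bigcup_(j in M) loners F M j
    :|: \bigcup_(i in [set: 'I_d]) \bigcup_(e in arcs F M i) joining F M i e.
  apply/fintype.subsetP => f _.
  have [/exists_inP[j jM fj]|nstab] := boolP [exists j in M, f \in stabbed F j].
    by rewrite !inE; apply/orP; left; apply/orP; left; apply/bigcupP; exists j.
  have [c cM fc||] := @loner_or_joins _ _ _ _ _ maxM f.
  - have [fj|dis|half] := hF f c cM.
    + case/exists_inP: nstab; exists c => //; rewrite inE; exact/asboolP.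
    + by have [p] := (meet_common_point _ _).1 fc; rewrite dis.
    + exact: pokes_of_half_corners half.
  - case=> j jM fj; rewrite !inE; apply/orP; left; apply/orP; right.
    by apply/bigcupP; exists j.
  - case=> i [a [b fab]]; rewrite !inE; apply/orP; right.
    apply/bigcupP; exists i => //.
    have fj : f \in joining F M i (a, b) by rewrite inE.
    by apply/bigcupP; exists (a, b) => //; rewrite inE; apply/set0Pn; exists f.
apply/tau_le/(piercedS cover).
have pS := pierced_bigcup (D := M) (fun j _ => pierced_stabbed F j).
have pL := pierced_bigcup (D := M) (fun j _ => pierced_loners maxM j).
have pJ i := pierced_bigcup (D := arcs F M i)
  (fun e _ => pierced_joining maxM i e).
have pA := pierced_bigcup (D := [set: 'I_d]) (fun i _ => pJ i).
apply: pierced_leq (piercedU (piercedU pS pL) pA).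
have arc_points i :
    \sum_(e in arcs F M i) (1 + (e \in doubled_arcs F M i) * d.-1) <=
    #|M| * (3 + d).
  have dbl : \sum_(e in arcs F M i) (e \in doubled_arcs F M i) <= #|M|.
    apply: leq_trans (card_doubled_arcs maxM i).
    rewrite -sum1_card [leqLHS]big_mkcond [leqRHS]big_mkcond.
    apply: leq_sum => e _.
    by case: (e \in arcs _ _ _); case: (e \in doubled_arcs _ _ _).
  have -> : 3 + d = 4 + d.-1 by lia.
  rewrite big_split /= sum1_card -big_distrl /= mulnDr [_ * 4]mulnC.
  by rewrite leq_add ?leq_mul2r ?dbl ?orbT ?card_arcs.
rewrite !sum_nat_const muln1.
apply: (@leq_trans (#|M| * 2 ^ d + #|M| + d * (#|M| * (3 + d)))).
  have <- : \sum_(i in [set: 'I_d]) #|M| * (3 + d) = d * (#|M| * (3 + d)).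
    by rewrite sum_nat_const cardsT card_ord.
  by rewrite leq_add2l; apply: leq_sum => i _; exact: arc_points.
move: (2 ^ d) #|M| => x m; nia.
Qed.
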